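(* Let $n$ be a positive integer. Then there is a natural isomorphism $\iota[n]=\{\iota[n]_R:MC_n(R)[x]\to MC_n(R[x])\}_{R\in\mathfrak{R}}$ between the functors $R\mapsto MC_n(R)[x]$ and $R\mapsto MC_n(R[x])$ from $\mathfrak{R}$ to $\mathfrak{R}$.
   Context: All rings are associative with $1$; ring morphisms preserve $1$; $\mathfrak{R}$ is the category of rings. $R[x]$ is the polynomial ring in one (central) indeterminate $x$. $M_m(R)$ is the ring of $m\times m$ matrices over $R$, and for a ring morphism $f:R\to S$, $M_m(f):M_m(R)\to M_m(S)$ applies $f$ entrywise. For $n\ge 1$ let $\eta^n_R:R\to M_n(R)$, $\eta^n_R(a)_{ij}=a\delta_{ij}$ (scalar matrices). Identify $M_n(M_{n^k}(R))$ with $M_{n^{k+1}}(R)$ via block matrices. For $n$ fixed, consider the direct system indexed by $k\in\mathbb{N}=\{0,1,2,\dots\}$ with objects $M_{n^k}(R)$ (so $M_{n^0}(R)=R$) and connecting maps $\eta^n_{M_{n^k}(R)}:M_{n^k}(R)\to M_{n^{k+1}}(R)$ (sending $A$ to the block diagonal matrix with $n$ diagonal blocks equal to $A$) and their composites. The $n$-matricial closure $MC_n(R)$ is the direct limit of this system in $\mathfrak{R}$, with canonical morphisms $i[R]^n_k:M_{n^k}(R)\to MC_n(R)$. For a ring morphism $f:R\to S$, $MC_n(f):MC_n(R)\to MC_n(S)$ is the unique ring morphism with $MC_n(f)\circ i[R]^n_k=i[S]^n_k\circ M_{n^k}(f)$ for all $k\in\mathbb{N}$. This makes $MC_n$ a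 functor $\mathfrak{R}\to\mathfrak{R}$. *)

(* Defs.v *)
From HB Require Import structures.
From mathcomp Require Import all_boot all_order all_algebra.
From mathcomp Require Import boolp zify.

Set Implicit Arguments.
Unset Strict Implicit.
Unset Printing Implicit Defensive.

Import GRing.Theory.
Local Open Scope ring_scope.
Local Open Scope quotient_scope.

(* Rings are [pzRingType]s: associative, unital, possibly trivial.            *)

(* Morphisms are compared pointwise, hence the field [fmap_ext].              *)
Record ringFunctor := RingFunctor {
  fobj :> pzRingType -> pzRingType;
  fmap : forall R S : pzRingType, {rmorphism R -> S} ->
                                  {rmorphism fobj R -> fobj S};
  fmap_ext : forall (R S : pzRingType) (f g : {rmorphism R -> S}),
    f =1 g -> fmap f =1 fmap g;
  fmap_id : forall R : pzRingType, fmap (idfun : {rmorphism R -> R}) =1 id;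
  fmap_comp : forall (R S T : pzRingType)
      (g : {rmorphism S -> T}) (f : {rmorphism R -> S}),
    fmap (g \o f : {rmorphism R -> T}) =1 fmap g \o fmap f }.

Arguments fmap F {R S} f : rename.

Section Composition.
Variables G F : ringFunctor.

Definition compF_map (R S : pzRingType) (f : {rmorphism R -> S}) :
  {rmorphism G (F R) -> G (F S)} := fmap G (fmap F f).

Fact compF_ext (R S : pzRingType) (f g : {rmorphism R -> S}) :
  f =1 g -> compF_map f =1 compF_map g.
Proof. by move=> fg; apply/fmap_ext/fmap_ext. Qed.

Fact compF_id (R : pzRingType) : compF_map (idfun : {rmorphism R -> R}) =1 id.
Proof.
by move=> x; rewrite -[RHS](fmap_id (r := G)); apply/fmap_ext/fmap_id.
Qed.

Fact compF_comp (R S T : pzRingType)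
    (g : {rmorphism S -> T}) (f : {rmorphism R -> S}) :
  compF_map (g \o f : {rmorphism R -> T}) =1 compF_map g \o compF_map f.
Proof.
by move=> x; rewrite /= -[RHS](fmap_comp (r := G)); apply/fmap_ext/fmap_comp.
Qed.

Definition compF : ringFunctor := RingFunctor compF_ext compF_id compF_comp.
End Composition.

Definition natural (F G : ringFunctor)
    (t : forall R : pzRingType, {rmorphism F R -> G R}) : Prop :=
  forall (R S : pzRingType) (f : {rmorphism R -> S}),
    t S \o fmap F f =1 fmap G f \o t R.

Definition natural_iso (F G : ringFunctor)
    (t : forall R : pzRingType, {rmorphism F R -> G R}) : Prop :=
  natural t /\ forall R : pzRingType, bijective (t R).

(* The library's {poly R} requires 1 != 0 in R.  Here a polynomial is its     *)
(* coefficient sequence, with finite support; [poly_rpoly_iso] below shows    *)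
(* that over a nontrivial ring this is {poly R}.                              *)
Record rpoly (R : pzRingType) := RPoly {
  pcoef : nat -> R;
  pcoefP : `[< exists N, forall i, (N <= i)%N -> pcoef i = 0 >] }.

Section RPoly.
Variable R : pzRingType.

HB.instance Definition _ := [isSub for @pcoef R].
HB.instance Definition _ := [Choice of rpoly R by <:].

Implicit Types p q r : rpoly R.

Lemma rpolyP p q : pcoef p =1 pcoef q <-> p = q.
Proof. by split=> [/funext e|-> //]; apply: val_inj. Qed.

Lemma pcoef_bound p : exists N, forall i, (N <= i)%N -> pcoef p i = 0.
Proof. exact/asboolP/pcoefP. Qed.

Fact rpoly0_subproof :
  `[< exists N, forall i, (N <= i)%N -> (fun=> 0 : R) i = 0 >].
Proof. by apply/asboolP; exists 0%N. Qed.
Definition rpoly0 := RPoly rpoly0_subproof.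

Fact rpoly1_subproof :
  `[< exists N, forall i, (N <= i)%N -> (fun i => (i == 0)%N%:R : R) i = 0 >].
Proof. by apply/asboolP; exists 1%N => -[]. Qed.
Definition rpoly1 := RPoly rpoly1_subproof.

Fact rpoly_opp_subproof p :
  `[< exists N, forall i, (N <= i)%N -> (fun i => - pcoef p i) i = 0 >].
Proof.
by apply/asboolP; have [N pN] := pcoef_bound p; exists N => i /pN ->; rewrite oppr0.
Qed.
Definition rpoly_opp p := RPoly (rpoly_opp_subproof p).

Fact rpoly_add_subproof p q :
  `[< exists N, forall i, (N <= i)%N -> (fun i => pcoef p i + pcoef q i) i = 0 >].
Proof.
apply/asboolP; have [[N pN] [M qM]] := (pcoef_bound p, pcoef_bound q).
by exists (maxn N M) => i; rewrite geq_max => /andP[/pN-> /qM->]; rewrite addr0.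
Qed.
Definition rpoly_add p q := RPoly (rpoly_add_subproof p q).

Fact rpoly_mul_subproof p q :
  `[< exists N, forall i, (N <= i)%N ->
      (fun i => \sum_(j < i.+1) pcoef p j * pcoef q (i - j)) i = 0 >].
Proof.
apply/asboolP; have [[N pN] [M qM]] := (pcoef_bound p, pcoef_bound q).
exists (N + M)%N => i le_i; apply: big1 => j _.
have [/pN->|lt_jN] := leqP N j; first by rewrite mul0r.
rewrite qM ?mulr0 // leq_subRL; last by rewrite -ltnS.
by rewrite (leq_trans _ le_i) // leq_add2r ltnW.
Qed.
Definition rpoly_mul p q := RPoly (rpoly_mul_subproof p q).

Fact rpoly_addA : associative rpoly_add.
Proof. by move=> p q r; apply/rpolyP => i /=; rewrite addrA. Qed.
Fact rpoly_addC : commutative rpoly_add.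
Proof. by move=> p q; apply/rpolyP => i /=; rewrite addrC. Qed.
Fact rpoly_add0 : left_id rpoly0 rpoly_add.
Proof. by move=> p; apply/rpolyP => i /=; rewrite add0r. Qed.
Fact rpoly_addN : left_inverse rpoly0 rpoly_opp rpoly_add.
Proof. by move=> p; apply/rpolyP => i /=; rewrite addNr. Qed.

HB.instance Definition _ := GRing.isZmodule.Build (rpoly R)
  rpoly_addA rpoly_addC rpoly_add0 rpoly_addN.

Fact rpoly_mulE p q i :
  pcoef (rpoly_mul p q) i = \sum_(j < i.+1) pcoef p j * pcoef q (i - j).
Proof. by []. Qed.

Fact rpoly_mulEr p q i :
  pcoef (rpoly_mul p q) i = \sum_(j < i.+1) pcoef p (i - j) * pcoef q j.
Proof.
rewrite rpoly_mulE (reindex_inj rev_ord_inj) /=.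
by apply: eq_bigr => j _; rewrite (sub_ordK j).
Qed.

Fact rpoly_mulA : associative rpoly_mul.
Proof.
move=> p q r; apply/rpolyP=> i; rewrite (rpoly_mulE p) (rpoly_mulEr _ r).
pose coef3 j k := pcoef p j * (pcoef q (i - j - k)%N * pcoef r k).
transitivity (\sum_(j < i.+1) \sum_(k < i.+1 | (k <= i - j)%N) coef3 j k).
  apply: eq_bigr => j _; rewrite rpoly_mulEr big_distrr /=.
  by rewrite (big_ord_narrow_leq (leq_subr _ _)).
rewrite (exchange_big_dep predT) //; apply: eq_bigr => k _.
transitivity (\sum_(j < i.+1 | (j <= i - k)%N) coef3 j k).
  apply: eq_bigl => j; rewrite -ltnS -(ltnS j) -!subSn ?leq_ord //.
  by rewrite -subn_gt0 -(subn_gt0 j) -!subnDA addnC.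
rewrite (big_ord_narrow_leq (leq_subr _ _)) rpoly_mulE big_distrl /=.
by apply: eq_bigr => j _; rewrite /coef3 -!subnDA addnC mulrA.
Qed.

Fact rpoly_mul1p : left_id rpoly1 rpoly_mul.
Proof.
move=> p; apply/rpolyP => i; rewrite rpoly_mulE big_ord_recl subn0 /= mul1r.
by rewrite big1 ?addr0 // => j _; rewrite mul0r.
Qed.

Fact rpoly_mulp1 : right_id rpoly1 rpoly_mul.
Proof.
move=> p; apply/rpolyP => i; rewrite rpoly_mulEr big_ord_recl subn0 /= mulr1.
by rewrite big1 ?addr0 // => j _; rewrite mulr0.
Qed.

Fact rpoly_mulDl : left_distributive rpoly_mul +%R.
Proof.
move=> p q r; apply/rpolyP => i /=; rewrite -big_split /=.
by apply: eq_bigr => j _; rewrite mulrDl.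
Qed.

Fact rpoly_mulDr : right_distributive rpoly_mul +%R.
Proof.
move=> p q r; apply/rpolyP => i /=; rewrite -big_split /=.
by apply: eq_bigr => j _; rewrite mulrDr.
Qed.

HB.instance Definition _ := GRing.Zmodule_isPzRing.Build (rpoly R)
  rpoly_mulA rpoly_mul1p rpoly_mulp1 rpoly_mulDl rpoly_mulDr.

Lemma pcoef_rpolyB p q i : pcoef (p - q) i = pcoef p i - pcoef q i.
Proof. by []. Qed.
Lemma pcoef_rpolyM p q i :
  pcoef (p * q) i = \sum_(j < i.+1) pcoef p j * pcoef q (i - j).
Proof. by []. Qed.
Lemma pcoef_rpoly1 i : pcoef (1 : rpoly R) i = (i == 0)%N%:R.
Proof. by []. Qed.
End RPoly.

Section RPolyMap.
Variables (R S : pzRingType) (f : {rmorphism R -> S}).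

Fact map_rpoly_subproof (p : rpoly R) :
  `[< exists N, forall i, (N <= i)%N -> (f \o pcoef p) i = 0 >].
Proof.
by apply/asboolP; have [N pN] := pcoef_bound p; exists N => i /pN /= ->; rewrite rmorph0.
Qed.
Definition map_rpoly (p : rpoly R) : rpoly S := RPoly (map_rpoly_subproof p).

Fact map_rpoly_zmod : zmod_morphism map_rpoly.
Proof. by move=> p q; apply/rpolyP => i /=; rewrite rmorphB. Qed.
Fact map_rpoly_monoid : monoid_morphism map_rpoly.
Proof.
split=> [|p q]; apply/rpolyP => i /=; first by rewrite rmorph_nat.
by rewrite rmorph_sum; apply: eq_bigr => j _; rewrite rmorphM.
Qed.
HB.instance Definition _ :=
  GRing.isZmodMorphism.Build (rpoly R) (rpoly S) map_rpoly map_rpoly_zmod.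
HB.instance Definition _ :=
  GRing.isMonoidMorphism.Build (rpoly R) (rpoly S) map_rpoly map_rpoly_monoid.
End RPolyMap.

Definition polyF_map (R S : pzRingType) (f : {rmorphism R -> S}) :
  {rmorphism rpoly R -> rpoly S} := map_rpoly f.

Fact polyF_ext (R S : pzRingType) (f g : {rmorphism R -> S}) :
  f =1 g -> polyF_map f =1 polyF_map g.
Proof. by move=> fg p; apply/rpolyP => i /=; rewrite fg. Qed.
Fact polyF_id (R : pzRingType) : polyF_map (idfun : {rmorphism R -> R}) =1 id.
Proof. by move=> p; apply/rpolyP. Qed.
Fact polyF_comp (R S T : pzRingType)
    (g : {rmorphism S -> T}) (f : {rmorphism R -> S}) :
  polyF_map (g \o f : {rmorphism R -> T}) =1 polyF_map g \o polyF_map f.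
Proof. by move=> p; apply/rpolyP. Qed.

Definition polyF : ringFunctor :=
  @RingFunctor (fun R => rpoly R) polyF_map polyF_ext polyF_id polyF_comp.

Section RPolyVsPoly.
Variable R : nzRingType.

Fact rpoly_of_poly_subproof (p : {poly R}) :
  `[< exists N, forall i, (N <= i)%N -> (fun i => p`_i) i = 0 >].
Proof. by apply/asboolP; exists (size p) => i; apply: nth_default. Qed.
Definition rpoly_of_poly (p : {poly R}) : rpoly R :=
  RPoly (rpoly_of_poly_subproof p).

Fact rpoly_of_poly_zmod : zmod_morphism rpoly_of_poly.
Proof. by move=> p q; apply/rpolyP => i /=; rewrite coefB. Qed.
Fact rpoly_of_poly_monoid : monoid_morphism rpoly_of_poly.
Proof.
by split=> [|p q]; apply/rpolyP => i /=; rewrite (coef1, coefM).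
Qed.
HB.instance Definition _ :=
  GRing.isZmodMorphism.Build {poly R} (rpoly R) rpoly_of_poly rpoly_of_poly_zmod.
HB.instance Definition _ :=
  GRing.isMonoidMorphism.Build {poly R} (rpoly R) rpoly_of_poly rpoly_of_poly_monoid.

Lemma poly_rpoly_iso : bijective (rpoly_of_poly : {rmorphism {poly R} -> rpoly R}).
Proof.
pose N p := sval (cid (pcoef_bound (p : rpoly R))).
have NP p : forall i, (N p <= i)%N -> pcoef p i = 0 := svalP (cid (pcoef_bound p)).
have gK p i : (\poly_(j < N p) pcoef p j)`_i = pcoef p i.
  by rewrite coef_poly; case: ltnP => // /NP ->.
exists (fun p => \poly_(i < N p) pcoef p i) => p.
  by apply/polyP => i; rewrite gK.
by apply/rpolyP => i /=; rewrite gK.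
Qed.
End RPolyVsPoly.

Section SeqLim.
Variables (X : nat -> pzRingType) (f : forall k : nat, {rmorphism X k -> X k.+1}).

(* For k <= m, [seqtrans k m] is the composite X k -> ... -> X m of the       *)
(* connecting maps; its value for m < k is junk.                              *)
Fixpoint seqtrans (k m : nat) {struct m} : X k -> X m :=
  match k =P m with
  | ReflectT e => fun a => ecast j (X j) e a
  | ReflectF _ =>
    match m return X k -> X m with
    | 0 => fun=> 0
    | m'.+1 => fun a => f m' (seqtrans m' a)
    end
  end.

Arguments seqtrans : clear implicits.

Lemma seqtrans_id k a : seqtrans k k a = a.
Proof. by case: k a => [|k] a /=; case: eqP => // e; rewrite eq_axiomK. Qed.

Lemma seqtransS k m a :
  (k <= m)%N -> seqtrans k m.+1 a = f m (seqtrans k m a).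
Proof. by move=> le_km /=; case: eqP => // e; rewrite e ltnn in le_km. Qed.

Lemma seqtrans_trans k l m a : (k <= l <= m)%N ->
  seqtrans l m (seqtrans k l a) = seqtrans k m a.
Proof.
case/andP=> le_kl; elim: m => [|m IHm].
  rewrite leqn0 => /eqP l0; rewrite l0 in le_kl *.
  by rewrite seqtrans_id.
rewrite leq_eqVlt => /predU1P[<-|]; first by rewrite seqtrans_id.
rewrite ltnS => le_lm; rewrite !seqtransS ?IHm //.
exact: leq_trans le_lm.
Qed.

Lemma seqtransB k m a b : (k <= m)%N ->
  seqtrans k m (a - b) = seqtrans k m a - seqtrans k m b.
Proof.
elim: m => [|m IHm]; first by rewrite leqn0 => /eqP k0; subst k; rewrite !seqtrans_id.
rewrite leq_eqVlt => /predU1P[e|]; first by subst k; rewrite !seqtrans_id.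
by rewrite ltnS => le_km; rewrite !seqtransS // IHm // rmorphB.
Qed.

Lemma seqtransM k m a b : (k <= m)%N ->
  seqtrans k m (a * b) = seqtrans k m a * seqtrans k m b.
Proof.
elim: m => [|m IHm]; first by rewrite leqn0 => /eqP k0; subst k; rewrite !seqtrans_id.
rewrite leq_eqVlt => /predU1P[e|]; first by subst k; rewrite !seqtrans_id.
by rewrite ltnS => le_km; rewrite !seqtransS // IHm // rmorphM.
Qed.

Lemma seqtrans1 k m : (k <= m)%N -> seqtrans k m 1 = 1.
Proof.
elim: m => [|m IHm]; first by rewrite leqn0 => /eqP k0; subst k; rewrite seqtrans_id.
rewrite leq_eqVlt => /predU1P[e|]; first by subst k; rewrite seqtrans_id.
by rewrite ltnS => le_km; rewrite seqtransS // IHm // rmorph1.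
Qed.

Lemma seqtrans0 k m : (k <= m)%N -> seqtrans k m 0 = 0.
Proof. by move=> le_km; rewrite -(subrr 0) seqtransB // subrr. Qed.
Lemma seqtransN k m a : (k <= m)%N -> seqtrans k m (- a) = - seqtrans k m a.
Proof. by move=> le_km; rewrite -sub0r seqtransB // seqtrans0 // sub0r. Qed.
Lemma seqtransD k m a b : (k <= m)%N ->
  seqtrans k m (a + b) = seqtrans k m a + seqtrans k m b.
Proof. by move=> le_km; rewrite -[b in LHS]opprK seqtransB // seqtransN // opprK. Qed.

Definition seqlim_rel (u v : {k : nat & X k}) : bool :=
  `[< exists m, [/\ (tag u <= m)%N, (tag v <= m)%N &
       seqtrans (tag u) m (tagged u) = seqtrans (tag v) m (tagged v)] >].

Fact seqlim_rel_refl : reflexive seqlim_rel.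
Proof. by move=> u; apply/asboolP; exists (tag u). Qed.
Fact seqlim_rel_sym : symmetric seqlim_rel.
Proof.
by move=> u v; apply/asboolP/asboolP => -[m [hu hv e]]; exists m.
Qed.
Fact seqlim_rel_trans : transitive seqlim_rel.
Proof.
move=> v u w /asboolP[m [um vm euv]] /asboolP[p [vp wp evw]].
have [mM pM] := (leq_maxl m p, leq_maxr m p).
apply/asboolP; exists (maxn m p); split.
- exact: leq_trans mM.
- exact: leq_trans pM.
rewrite -(@seqtrans_trans _ m) ?um // euv seqtrans_trans ?vm //.
by rewrite -(@seqtrans_trans _ p) ?vp // evw seqtrans_trans ?wp.
Qed.
Canonical seqlim_equiv :=
  EquivRel seqlim_rel seqlim_rel_refl seqlim_rel_sym seqlim_rel_trans.

Definition seqlim := {eq_quot seqlim_equiv}.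
HB.instance Definition _ := Choice.on seqlim.

Definition seqlim_in (k : nat) (a : X k) : seqlim :=
  \pi_{eq_quot seqlim_equiv} (Tagged X a).

Arguments seqlim_in : clear implicits.

Lemma seqlim_in_eq k l a b : seqlim_in k a = seqlim_in l b <->
  exists m, [/\ (k <= m)%N, (l <= m)%N & seqtrans k m a = seqtrans l m b].
Proof. by split=> [/eqmodP/asboolP|e]; last exact/eqmodP/asboolP. Qed.

Lemma seqlim_inT k m a : (k <= m)%N -> seqlim_in m (seqtrans k m a) = seqlim_in k a.
Proof.
by move=> km; apply/seqlim_in_eq; exists m; split=> //; rewrite seqtrans_id.
Qed.

Lemma seqlim_inS k a : seqlim_in k.+1 (f k a) = seqlim_in k a.
Proof. by rewrite -(@seqlim_inT k k.+1) // seqtransS // seqtrans_id. Qed.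

Lemma seqlim_repr (u : seqlim) : seqlim_in (tag (repr u)) (tagged (repr u)) = u.
Proof. by rewrite /seqlim_in; move: (reprK u); case: (repr u). Qed.

Definition seqlim_add (u v : seqlim) : seqlim :=
  let m := maxn (tag (repr u)) (tag (repr v)) in
  seqlim_in m (seqtrans _ m (tagged (repr u)) + seqtrans _ m (tagged (repr v))).
Definition seqlim_mul (u v : seqlim) : seqlim :=
  let m := maxn (tag (repr u)) (tag (repr v)) in
  seqlim_in m (seqtrans _ m (tagged (repr u)) * seqtrans _ m (tagged (repr v))).
Definition seqlim_opp (u : seqlim) : seqlim :=
  seqlim_in (tag (repr u)) (- tagged (repr u)).
Definition seqlim0 : seqlim := seqlim_in 0 0.
Definition seqlim1 : seqlim := seqlim_in 0 1.

Fact seqlim_common (u v w : seqlim) : exists m (a b c : X m),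
  [/\ u = seqlim_in m a, v = seqlim_in m b & w = seqlim_in m c].
Proof.
pose m := (tag (repr u) + tag (repr v) + tag (repr w))%N.
exists m, (seqtrans _ m (tagged (repr u))), (seqtrans _ m (tagged (repr v))),
  (seqtrans _ m (tagged (repr w))).
have le3 (a b c : nat) : [/\ a <= a + b + c, b <= a + b + c & c <= a + b + c]%N by split; lia.
by have [? ? ?] := le3 (tag (repr u)) (tag (repr v)) (tag (repr w));
  split; rewrite seqlim_inT ?seqlim_repr.
Qed.

Fact seqlim_addE k a b :
  seqlim_add (seqlim_in k a) (seqlim_in k b) = seqlim_in k (a + b).
Proof.
rewrite /seqlim_add; set u := repr _; set v := repr _; set m := maxn _ _.
have [mu mv] : (tag u <= m)%N /\ (tag v <= m)%N by rewrite leq_maxl leq_maxr; split.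
have /seqlim_in_eq[p [up kp eu]] := seqlim_repr (seqlim_in k a).
have /seqlim_in_eq[q [vq kq ev]] := seqlim_repr (seqlim_in k b).
rewrite -/u in up eu; rewrite -/v in vq ev.
pose M := (m + p + q)%N.
have [mM kM pM qM] : [/\ m <= M, k <= M, p <= M & q <= M]%N by rewrite /M; clearbody m; split; lia.
apply/seqlim_in_eq; exists M; split=> //.
rewrite !seqtransD // !seqtrans_trans ?mu ?mv //.
rewrite -(@seqtrans_trans (tag u) p) ?up // eu seqtrans_trans ?kp //.
by rewrite -(@seqtrans_trans (tag v) q) ?vq // ev seqtrans_trans ?kq.
Qed.

Fact seqlim_mulE k a b :
  seqlim_mul (seqlim_in k a) (seqlim_in k b) = seqlim_in k (a * b).
Proof.
rewrite /seqlim_mul; set u := repr _; set v := repr _; set m := maxn _ _.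
have [mu mv] : (tag u <= m)%N /\ (tag v <= m)%N by rewrite leq_maxl leq_maxr; split.
have /seqlim_in_eq[p [up kp eu]] := seqlim_repr (seqlim_in k a).
have /seqlim_in_eq[q [vq kq ev]] := seqlim_repr (seqlim_in k b).
rewrite -/u in up eu; rewrite -/v in vq ev.
pose M := (m + p + q)%N.
have [mM kM pM qM] : [/\ m <= M, k <= M, p <= M & q <= M]%N by rewrite /M; clearbody m; split; lia.
apply/seqlim_in_eq; exists M; split=> //.
rewrite !seqtransM // !seqtrans_trans ?mu ?mv //.
rewrite -(@seqtrans_trans (tag u) p) ?up // eu seqtrans_trans ?kp //.
by rewrite -(@seqtrans_trans (tag v) q) ?vq // ev seqtrans_trans ?kq.
Qed.

Fact seqlim_oppE k a : seqlim_opp (seqlim_in k a) = seqlim_in k (- a).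
Proof.
have /seqlim_in_eq[p [up kp eu]] := seqlim_repr (seqlim_in k a).
by apply/seqlim_in_eq; exists p; rewrite !seqtransN ?eu.
Qed.

Fact seqlim0E k : seqlim0 = seqlim_in k 0.
Proof. by rewrite -(@seqtrans0 0 k) // seqlim_inT. Qed.
Fact seqlim1E k : seqlim1 = seqlim_in k 1.
Proof. by rewrite -(@seqtrans1 0 k) // seqlim_inT. Qed.

Fact seqlim_addA : associative seqlim_add.
Proof.
move=> u v w; have [m [a [b [c [-> -> ->]]]]] := seqlim_common u v w.
by rewrite !seqlim_addE addrA.
Qed.
Fact seqlim_addC : commutative seqlim_add.
Proof.
move=> u v; have [m [a [b [_ [-> -> _]]]]] := seqlim_common u v u.
by rewrite !seqlim_addE addrC.
Qed.
Fact seqlim_add0 : left_id seqlim0 seqlim_add.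
Proof.
move=> u; have [m [a [_ [_ [-> _ _]]]]] := seqlim_common u u u.
by rewrite (seqlim0E m) seqlim_addE add0r.
Qed.
Fact seqlim_addN : left_inverse seqlim0 seqlim_opp seqlim_add.
Proof.
move=> u; have [m [a [_ [_ [-> _ _]]]]] := seqlim_common u u u.
by rewrite (seqlim0E m) seqlim_oppE seqlim_addE addNr.
Qed.
HB.instance Definition _ := GRing.isZmodule.Build seqlim
  seqlim_addA seqlim_addC seqlim_add0 seqlim_addN.

Fact seqlim_mulA : associative seqlim_mul.
Proof.
move=> u v w; have [m [a [b [c [-> -> ->]]]]] := seqlim_common u v w.
by rewrite !seqlim_mulE mulrA.
Qed.
Fact seqlim_mul1l : left_id seqlim1 seqlim_mul.
Proof.
move=> u; have [m [a [_ [_ [-> _ _]]]]] := seqlim_common u u u.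
by rewrite (seqlim1E m) seqlim_mulE mul1r.
Qed.
Fact seqlim_mul1r : right_id seqlim1 seqlim_mul.
Proof.
move=> u; have [m [a [_ [_ [-> _ _]]]]] := seqlim_common u u u.
by rewrite (seqlim1E m) seqlim_mulE mulr1.
Qed.
Fact seqlim_mulDl : left_distributive seqlim_mul seqlim_add.
Proof.
move=> u v w; have [m [a [b [c [-> -> ->]]]]] := seqlim_common u v w.
by rewrite !(seqlim_addE, seqlim_mulE) mulrDl.
Qed.
Fact seqlim_mulDr : right_distributive seqlim_mul seqlim_add.
Proof.
move=> u v w; have [m [a [b [c [-> -> ->]]]]] := seqlim_common u v w.
by rewrite !(seqlim_addE, seqlim_mulE) mulrDr.
Qed.
HB.instance Definition _ := GRing.Zmodule_isPzRing.Build seqlim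
  seqlim_mulA seqlim_mul1l seqlim_mul1r seqlim_mulDl seqlim_mulDr.

Section In.
Variable k : nat.
Fact seqlim_in_zmod : zmod_morphism (seqlim_in k).
Proof. by move=> a b; rewrite -seqlim_addE -seqlim_oppE. Qed.
Fact seqlim_in_monoid : monoid_morphism (seqlim_in k).
Proof. by split=> [|a b]; [exact/esym/seqlim1E | exact/esym/seqlim_mulE]. Qed.
HB.instance Definition _ :=
  GRing.isZmodMorphism.Build (X k) seqlim (seqlim_in k) seqlim_in_zmod.
HB.instance Definition _ :=
  GRing.isMonoidMorphism.Build (X k) seqlim (seqlim_in k) seqlim_in_monoid.
End In.

Section Desc.
Variables (Y : pzRingType) (g : forall k : nat, {rmorphism X k -> Y}).
Hypothesis gf : forall (k : nat) (a : X k), g k.+1 (f k a) = g k a.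

Definition seqlim_desc_fun (u : seqlim) : Y := g (tag (repr u)) (tagged (repr u)).

Fact seqlim_desc_trans k m a : (k <= m)%N -> g m (seqtrans k m a) = g k a.
Proof.
elim: m => [|m IHm]; first by rewrite leqn0 => /eqP k0; subst k; rewrite seqtrans_id.
rewrite leq_eqVlt => /predU1P[e|]; first by subst k; rewrite seqtrans_id.
by rewrite ltnS => le_km; rewrite seqtransS // gf IHm.
Qed.

Fact seqlim_desc_funE k a : seqlim_desc_fun (seqlim_in k a) = g k a.
Proof.
have /seqlim_in_eq[p [up kp eu]] := seqlim_repr (seqlim_in k a).
by rewrite /seqlim_desc_fun -(seqlim_desc_trans _ up) eu seqlim_desc_trans.
Qed.

Fact seqlim_desc_zmod : zmod_morphism seqlim_desc_fun.
Proof.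
move=> u v; have [m [a [b [_ [-> -> _]]]]] := seqlim_common u v u.
by rewrite -rmorphB !seqlim_desc_funE rmorphB.
Qed.
Fact seqlim_desc_monoid : monoid_morphism seqlim_desc_fun.
Proof.
split=> [|u v]; first by rewrite [1](seqlim1E 0) seqlim_desc_funE rmorph1.
have [m [a [b [_ [-> -> _]]]]] := seqlim_common u v u.
by rewrite -rmorphM !seqlim_desc_funE rmorphM.
Qed.

Definition seqlim_desc : {rmorphism seqlim -> Y} :=
  HB.pack_for {rmorphism seqlim -> Y} seqlim_desc_fun
    (GRing.isZmodMorphism.Build seqlim Y seqlim_desc_fun seqlim_desc_zmod)
    (GRing.isMonoidMorphism.Build seqlim Y seqlim_desc_fun seqlim_desc_monoid).

Lemma seqlim_descE k (a : X k) : seqlim_desc (seqlim_in k a) = g k a.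
Proof. exact: seqlim_desc_funE. Qed.

Lemma seqlim_desc_uniq (h : {rmorphism seqlim -> Y}) :
  (forall (k : nat) (a : X k), h (seqlim_in k a) = g k a) -> h =1 seqlim_desc.
Proof. by move=> hE u; rewrite -(seqlim_repr u) hE seqlim_descE. Qed.
End Desc.

End SeqLim.

Arguments seqtrans {X} f k m a.
Arguments seqlim_in {X} f k a.

Definition eta (n : nat) (R : pzRingType) : {rmorphism R -> 'M[R]_n} :=
  @scalar_mx R n.

Section Flatten.
Variables (n k : nat) (R : pzRingType).

Fact flatten_size : (\sum_(i < n) n ^ k = n ^ k.+1)%N.
Proof. by rewrite sum_nat_const card_ord expnS. Qed.

(* The identification of M_n(M_(n^k)(R)) with M_(n^(k+1))(R) by blocks; the   *)
(* cast only rewrites the dimension.                                          *)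
Definition flatten_mx (B : 'M['M[R]_(n ^ k)]_n) : 'M[R]_(n ^ k.+1) :=
  castmx (flatten_size, flatten_size) (\mxblock_(i < n, j < n) B i j).

Lemma flatten_scalar_mx (A : 'M[R]_(n ^ k)) :
  flatten_mx A%:M = castmx (flatten_size, flatten_size) (\mxdiag_(i < n) A).
Proof.
congr castmx; apply: eq_mxblock => i j.
by rewrite mxE conform_mx_id; case: eqP.
Qed.

Fact castmx_sub m p (e : m = p) (A B : 'M[R]_m) :
  castmx (e, e) (A - B) = castmx (e, e) A - castmx (e, e) B.
Proof. by case: _ / e; rewrite !castmx_id. Qed.
Fact castmx_mul_sq m p (e : m = p) (A B : 'M[R]_m) :
  castmx (e, e) (A *m B) = castmx (e, e) A *m castmx (e, e) B.
Proof. by case: _ / e; rewrite !castmx_id. Qed.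
Fact castmx_1 m p (e : m = p) : castmx (e, e) 1%:M = 1%:M :> 'M[R]_p.
Proof. by case: _ / e; rewrite !castmx_id. Qed.

Fact flatten_mx_zmod : zmod_morphism flatten_mx.
Proof.
move=> A B; rewrite /flatten_mx -castmx_sub -mxblockB; congr castmx.
by apply: eq_mxblock => i j; rewrite !mxE.
Qed.

Fact flatten_mx_monoid : monoid_morphism flatten_mx.
Proof.
split=> [|A B].
  by rewrite flatten_scalar_mx mxdiagZ castmx_1.
rewrite /flatten_mx -[RHS]castmx_mul_sq mul_mxblock; congr castmx.
by apply: eq_mxblock => i j; rewrite mxE.
Qed.

HB.instance Definition _ := GRing.isZmodMorphism.Build
  'M['M[R]_(n ^ k)]_n 'M[R]_(n ^ k.+1) flatten_mx flatten_mx_zmod.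
HB.instance Definition _ := GRing.isMonoidMorphism.Build
  'M['M[R]_(n ^ k)]_n 'M[R]_(n ^ k.+1) flatten_mx flatten_mx_monoid.

Definition MC_step : {rmorphism 'M[R]_(n ^ k) -> 'M[R]_(n ^ k.+1)} :=
  flatten_mx \o eta n 'M[R]_(n ^ k).

End Flatten.

Section MC.
Variable n : nat.

(* At k = 0 the ring R appears as its 1 x 1 matrices.                         *)
Definition MC_obj (R : pzRingType) (k : nat) : pzRingType := 'M[R]_(n ^ k).

Definition MC (R : pzRingType) : pzRingType :=
  @seqlim (MC_obj R) (fun k => MC_step n k R).

Definition MC_in (R : pzRingType) (k : nat) : {rmorphism 'M[R]_(n ^ k) -> MC R} :=
  (seqlim_in _ k : {rmorphism MC_obj R k -> @seqlim (MC_obj R) (fun k => MC_step n k R)}).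

Lemma MC_in_step (R : pzRingType) (k : nat) (A : 'M[R]_(n ^ k)) :
  MC_in R k.+1 (MC_step n k R A) = MC_in R k A.
Proof. exact: seqlim_inS. Qed.

Section Map.
Variables (R S : pzRingType) (f : {rmorphism R -> S}).

Definition mapM (m : nat) : {rmorphism 'M[R]_m -> 'M[S]_m} := @map_mx R S f m m.

Fact MC_step_nat k (A : 'M[R]_(n ^ k)) :
  MC_in S k.+1 (mapM _ (MC_step n k R A)) = MC_in S k (mapM _ A).
Proof.
rewrite -[RHS]seqlim_inS; congr (MC_in S _ _).
rewrite /= /flatten_mx map_castmx; congr castmx.
apply/matrixP => a b; rewrite !mxE !mulrb.
by case: ifP => _; rewrite !mxE ?rmorph0.
Qed.

Definition MC_map : {rmorphism MC R -> MC S} :=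
  seqlim_desc (g := fun k => MC_in S k \o mapM (n ^ k)) MC_step_nat.

Lemma MC_mapE (k : nat) (A : 'M[R]_(n ^ k)) :
  MC_map (MC_in R k A) = MC_in S k (map_mx f A).
Proof. exact: seqlim_descE. Qed.

Lemma MC_map_uniq (h : {rmorphism MC R -> MC S}) :
  (forall k (A : 'M[R]_(n ^ k)), h (MC_in R k A) = MC_in S k (map_mx f A)) ->
  h =1 MC_map.
Proof. by move=> hE; apply: seqlim_desc_uniq. Qed.
End Map.

Fact MC_ext (R S : pzRingType) (f g : {rmorphism R -> S}) :
  f =1 g -> MC_map f =1 MC_map g.
Proof.
move=> fg; apply: MC_map_uniq => k A; rewrite MC_mapE.
by congr (MC_in S k _); apply: eq_map_mx.
Qed.

Fact MC_id (R : pzRingType) : MC_map (idfun : {rmorphism R -> R}) =1 id.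
Proof.
move=> u; apply/esym/(MC_map_uniq (h := idfun : {rmorphism MC R -> MC R})).
by move=> k A; rewrite map_mx_id.
Qed.

Fact MC_comp (R S T : pzRingType)
    (g : {rmorphism S -> T}) (f : {rmorphism R -> S}) :
  MC_map (g \o f : {rmorphism R -> T}) =1 MC_map g \o MC_map f.
Proof.
move=> u; apply/esym/(MC_map_uniq (h := MC_map g \o MC_map f)) => k A.
rewrite -[LHS]/(MC_map g (MC_map f (MC_in R k A))) !MC_mapE.
by rewrite -map_mx_comp.
Qed.

Definition MCF : ringFunctor := RingFunctor MC_ext MC_id MC_comp.
End MC.

(* Main.v *)
(** The map goes more easily in the other direction.  Taking coefficients
    entrywise sends a matrix over R[x] to a polynomial over the matrix ring;
    this is compatible with the block-diagonal embeddings, hence descends to a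
    natural morphism MC(R[x]) -> MC(R)[x].  It is injective since the embeddings
    are (n > 0), and surjective since the finitely many nonzero coefficients of
    a polynomial over MC(R) all come from one stage M_(n^m)(R).  The required
    isomorphism is its inverse. *)

Require Import Defs.
From HB Require Import structures.
From mathcomp Require Import all_boot all_order all_algebra.
From mathcomp Require Import boolp.

Import GRing.Theory.
Local Open Scope ring_scope.

(** Only [h 0 = 0] is asked, so that [h] may be the extraction of a coefficient, which is not
    multiplicative: the entries of a block diagonal matrix are entries of [A] or zeros. *)
Lemma map_MC_step (R S : pzRingType) (h : R -> S) n k (A : 'M[R]_(n ^ k)) :
  h 0 = 0 -> map_mx h (MC_step n k R A) = MC_step n k S (map_mx h A).
Proof.
move=> h0; rewrite /= /flatten_mx map_castmx; congr castmx.
apply/matrixP => a b; rewrite !mxE !mulrb.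
by case: ifP => _; rewrite !mxE ?h0.
Qed.

(** Since [0 < n], there is a block of index (0, 0), and it returns [A]. *)
Lemma MC_step_inj n k (R : pzRingType) :
  (0 < n)%N -> injective (MC_step n k R).
Proof.
move=> n_gt0 A B /(can_inj (castmxK _ _)) /eq_mxblockP /(_ (Ordinal n_gt0)).
by move/(_ (Ordinal n_gt0)); rewrite !mxE eqxx.
Qed.

(** Equality in the limit already holds at some stage [m]; the connecting maps from [k] to [m] are
    then cancelled one by one. *)
Lemma seqlim_in_inj (X : nat -> pzRingType)
    (f : forall k, {rmorphism X k -> X k.+1}) k :
  (forall m, injective (f m)) -> injective (seqlim_in f k).
Proof.
move=> f_inj a b /seqlim_in_eq[m [le_km _]]; elim: m le_km => [|m IHm].
  by rewrite leqn0 => /eqP k0; subst k; rewrite !seqtrans_id.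
rewrite leq_eqVlt => /predU1P[e|]; first by subst k; rewrite !seqtrans_id.
by rewrite ltnS => le_km; rewrite !seqtransS // => /f_inj/IHm; apply.
Qed.

Lemma MC_in_inj n k (R : pzRingType) : (0 < n)%N -> injective (MC_in n R k).
Proof. by move=> n_gt0; apply: seqlim_in_inj => m; apply: MC_step_inj. Qed.

Lemma MC_in_surj n (R : pzRingType) (u : MC n R) :
  exists k (A : 'M[R]_(n ^ k)), u = MC_in n R k A.
Proof. by have [k [A [_ [_ [-> _ _]]]]] := seqlim_common u u u; exists k, A. Qed.

Lemma MC_in_trans n (R : pzRingType) k m (A : 'M[R]_(n ^ k)) :
  (k <= m)%N -> exists B, MC_in n R m B = MC_in n R k A.
Proof.
move=> le_km; exists (seqtrans (fun k => MC_step n k R) k m A).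
exact: seqlim_inT.
Qed.

Lemma MC_seq_lift n (R : pzRingType) (u : nat -> MC n R) N :
  exists m (c : nat -> 'M[R]_(n ^ m)),
    forall i, (i < N)%N -> MC_in n R m (c i) = u i.
Proof.
elim: N => [|N [m [c cE]]]; first by exists 0%N, (fun=> 0).
have [k [A uN]] := MC_in_surj n R (u N).
(* The old lifts and the lift of [u N] move to a common stage; indices above [N] get arbitrary
   values. *)
have lift i : exists B, MC_in n R (maxn m k) B =
    if i == N then MC_in n R k A else MC_in n R m (c i).
  by case: ifP => _; apply: MC_in_trans; rewrite ?leq_maxl ?leq_maxr.
have [d dE] := choice lift; exists (maxn m k), d => i.
by rewrite ltnS leq_eqVlt dE; case: eqP => [->|_ /cE].
Qed.

Section CoefMatrix.
Variables (R : pzRingType) (m : nat).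

Definition coef_mx (i : nat) (A : 'M[rpoly R]_m) : 'M[R]_m :=
  map_mx (fun p => pcoef p i) A.

Lemma coef_mxB i A B : coef_mx i (A - B) = coef_mx i A - coef_mx i B.
Proof. by apply/matrixP => a b; rewrite !mxE pcoef_rpolyB. Qed.

Lemma pcoef_sum I (r : seq I) (F : I -> rpoly R) i :
  pcoef (\sum_(j <- r) F j) i = \sum_(j <- r) pcoef (F j) i.
Proof. by apply: (big_morph (fun p => pcoef p i)). Qed.

(** The sum over the inner matrix index commutes with the convolution sum, so [coef_mx] behaves as
    the coefficients of a product of polynomials over the matrix ring. *)
Lemma coef_mxM i A B :
  coef_mx i (A * B) = \sum_(j < i.+1) coef_mx j A * coef_mx (i - j) B.
Proof.
apply/matrixP => a b; rewrite !mxE summxE pcoef_sum.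
under eq_bigr do rewrite pcoef_rpolyM.
rewrite exchange_big; apply: eq_bigr => j _; rewrite mxE.
by apply: eq_bigr => c _; rewrite !mxE.
Qed.

Lemma coef_mx1 i : coef_mx i 1 = (i == 0%N)%:R.
Proof.
by case: i => [|i]; apply/matrixP => a b; rewrite !mxE; case: (a == b).
Qed.

Lemma coef_mx_inj A B : (forall i, coef_mx i A = coef_mx i B) -> A = B.
Proof.
move=> eAB; apply/matrixP => a b; apply/rpolyP => i.
by have /matrixP/(_ a b) := eAB i; rewrite !mxE.
Qed.

Lemma coef_mx_bound A :
  exists N, forall i, (N <= i)%N -> coef_mx i A = 0.
Proof.
have [N NP] := choice (fun ab : 'I_m * 'I_m => pcoef_bound (A ab.1 ab.2)).
(* There are finitely many entries, so the largest of their bounds serves them all. *)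
exists (\max_ab N ab)%N => i le_i; apply/matrixP => a b; rewrite !mxE.
exact: (NP (a, b)) (leq_trans (leq_bigmax (a, b)) le_i).
Qed.

Lemma coef_mx_surj (c : nat -> 'M[R]_m) N :
  (forall i, (N <= i)%N -> c i = 0) -> exists A, forall i, coef_mx i A = c i.
Proof.
move=> c0; have cP a b :
    `[< exists N, forall i, (N <= i)%N -> (fun i => c i a b) i = 0 >].
  by apply/asboolP; exists N => i /c0 ->; rewrite mxE.
exists (\matrix_(a, b) RPoly (cP a b)) => i.
by apply/matrixP => a b; rewrite !mxE.
Qed.
End CoefMatrix.

Section CoefMorphism.
Variables (n : nat) (R : pzRingType).

Section Stage.
Variable k : nat.

Fact MC_coef_stage_subproof (A : 'M[rpoly R]_(n ^ k)) :
  `[< exists N, forall i, (N <= i)%N ->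
      (fun i => MC_in n R k (coef_mx R _ i A)) i = 0 >].
Proof.
apply/asboolP; have [N NP] := coef_mx_bound _ _ A.
by exists N => i /NP ->; rewrite rmorph0.
Qed.

Definition MC_coef_stage (A : 'M[rpoly R]_(n ^ k)) : rpoly (MC n R) :=
  RPoly (MC_coef_stage_subproof A).

Fact MC_coef_stage_zmod : zmod_morphism MC_coef_stage.
Proof. by move=> A B; apply/rpolyP => i /=; rewrite coef_mxB rmorphB. Qed.

Fact MC_coef_stage_monoid : monoid_morphism MC_coef_stage.
Proof.
split=> [|A B]; apply/rpolyP => i /=; first by rewrite coef_mx1 rmorph_nat.
by rewrite coef_mxM rmorph_sum; apply: eq_bigr => j _; rewrite rmorphM.
Qed.

HB.instance Definition _ := GRing.isZmodMorphism.Build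
  'M[rpoly R]_(n ^ k) (rpoly (MC n R)) MC_coef_stage MC_coef_stage_zmod.
HB.instance Definition _ := GRing.isMonoidMorphism.Build
  'M[rpoly R]_(n ^ k) (rpoly (MC n R)) MC_coef_stage MC_coef_stage_monoid.
End Stage.

(** This is the cocone condition that lets the stage maps descend to the limit. *)
Fact MC_coef_stageS k (A : 'M[rpoly R]_(n ^ k)) :
  MC_coef_stage k.+1 (MC_step n k (rpoly R) A) = MC_coef_stage k A.
Proof.
apply/rpolyP => i; rewrite -[RHS]MC_in_step.
by congr (MC_in n R _ _); apply: map_MC_step.
Qed.

Definition MC_coef : {rmorphism MC n (rpoly R) -> rpoly (MC n R)} :=
  seqlim_desc (X := MC_obj n (rpoly R))
    (g := fun k => MC_coef_stage k) MC_coef_stageS.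

Lemma MC_coefE k (A : 'M[rpoly R]_(n ^ k)) i :
  pcoef (MC_coef (MC_in n (rpoly R) k A)) i = MC_in n R k (coef_mx R _ i A).
Proof.
apply: (congr1 (fun p : rpoly (MC n R) => pcoef p i)
  (y := MC_coef_stage k A)).
exact: seqlim_descE.
Qed.

(** At a common stage, injectivity of [MC_in] turns equality of coefficients in the limit into
    equality of coefficient matrices. *)
Lemma MC_coef_inj : (0 < n)%N -> injective MC_coef.
Proof.
move=> n_gt0 u v; have [k [A [B [_ [-> -> _]]]]] := seqlim_common u v u.
move=> /rpolyP e; congr (MC_in n _ k _); apply: coef_mx_inj => i.
by apply: (MC_in_inj n k R n_gt0); rewrite -!MC_coefE e.
Qed.

Lemma MC_coef_surj p : exists u, MC_coef u = p.
Proof.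
have [N pN] := pcoef_bound p.
have [m [c cE]] := MC_seq_lift n R (pcoef p) N.
(* The lifts [c i] are uncontrolled from [N] on, hence the truncation. *)
have [|A AE] := coef_mx_surj R _ (fun i => if (i < N)%N then c i else 0) N.
  by move=> i; rewrite leqNgt => /negPf ->.
exists (MC_in n _ m A); apply/rpolyP => i; rewrite MC_coefE AE.
by case: ltnP => [/cE|/pN ->] //; rewrite rmorph0.
Qed.

Lemma MC_coef_bij : (0 < n)%N -> bijective MC_coef.
Proof.
move=> n_gt0; have [g gK] := choice MC_coef_surj.
by exists g => // u; apply: MC_coef_inj.
Qed.
End CoefMorphism.

Lemma MC_coef_natural n (R S : pzRingType) (f : {rmorphism R -> S}) u :
  MC_coef n S (MC_map n (polyF_map f) u) = polyF_map (MC_map n f) (MC_coef n R u).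
Proof.
have [k [A ->]] := MC_in_surj n _ u; apply/rpolyP => i.
rewrite MC_mapE MC_coefE.
rewrite -[RHS]/(MC_map n f (pcoef (MC_coef n R (MC_in n _ k A)) i)).
rewrite MC_coefE MC_mapE.
by congr (MC_in n S k _); apply/matrixP => a b; rewrite !mxE.
Qed.

Lemma rmorph_inverse (R S : pzRingType) (f : {rmorphism R -> S}) :
  bijective f -> exists g : {rmorphism S -> R}, cancel f g /\ cancel g f.
Proof.
case=> g fK gK.
by exists (HB.pack_for {rmorphism S -> R} g
  (GRing.isZmodMorphism.Build S R g (can2_zmod_morphism fK gK))
  (GRing.isMonoidMorphism.Build S R g (can2_monoid_morphism fK gK))).
Qed.

Theorem proposition8 (n : nat) (n_gt0 : (0 < n)%N) :
  exists iota : forall R : pzRingType, {rmorphism rpoly (MC n R) -> MC n (rpoly R)},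
    natural_iso (F := compF polyF (MCF n)) (G := compF (MCF n) polyF) iota.
Proof.
have inv (R : pzRingType) := rmorph_inverse _ _ _ (MC_coef_bij n R n_gt0).
pose iota R := projT1 (cid (inv R)).
have iotaK R : cancel (iota R) (MC_coef n R) := (projT2 (cid (inv R))).2.
have coefK R : cancel (MC_coef n R) (iota R) := (projT2 (cid (inv R))).1.
exists iota; split=> [R S f p|R]; last exact: Bijective (iotaK R) (coefK R).
(* Naturality passes to the inverse: after applying the injective [MC_coef n S] and writing [p] as
   the image of [iota R p], the square is that of [MC_coef]. *)
apply: (can_inj (coefK S)); apply: etrans (iotaK S _) _.
by rewrite -{1}(iotaK R p); exact/esym/MC_coef_natural.
Qed.
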